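(* Let $m\ge1$ and let $H=K_{5,\dots,5}$ be the complete $m$-partite graph with all parts of size $5$. Then for every $n$, $$b_H(n)\le\left(\frac{4}{3^{5/4}}\right)^{m-1}3^{n/4}.$$ This bound is attained if $n-5(m-1)$ is positive and divisible by $4$, namely by the graph join of $m-1$ copies of $I_5$ and $\frac{n-5(m-1)}{4}$ copies of $I_4$ (here $I_k$ is the edgeless graph on $k$ vertices, and the join of graphs is their disjoint union with all edges between different copies added).
   Context: For a graph $G$, $\mathrm{cl}(G)$ denotes its clique complex. For a finite simple graph $H$ and a fixed field $\mathbb{K}$, $b_H(n)=\max_G \sum_{i\ge -1}\dim_{\mathbb{K}}\widetilde H_i(\mathrm{cl}(G);\mathbb{K})$, where $G$ ranges over all simple graphs on at most $n$ vertices containing no induced copy of $H$ (reduced homology, the empty graph contributing $1$). ''Attained'' means the clique complex of the stated graph has total reduced Betti number equal to the bound. *)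

(* Defs.v *)
From HB Require Import structures.
From mathcomp Require Import all_boot all_order all_algebra.
From mathcomp Require Import reals exp.
Set Implicit Arguments. Unset Strict Implicit. Unset Printing Implicit Defensive.
Import Order.TTheory GRing.Theory Num.Theory.
Local Open Scope ring_scope.

(* A finite simple graph on vertex type V is a symmetric irreflexive rel V. *)

(* Cliques of G (the faces of cl(G)), including the empty face. *)
Definition is_clique (V : finType) (E : rel V) (A : {set V}) : bool :=
  [forall x in A, forall y in A, (x != y) ==> E x y].

(* cliques with exactly k vertices = (k-1)-dimensional faces of cl(G) *)
Definition cliques_of_size (V : finType) (E : rel V) (k : nat) : {set {set V}} :=
  [set A : {set V} | is_clique E A && (#|A| == k)].

Definition nfaces (V : finType) (E : rel V) (k : nat) : nat :=
  #|cliques_of_size E k|.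

(* Coefficient of the face B in the boundary of the face A, for the vertex order
   given by enum_rank: (-1)^j where the removed vertex is the j-th of A (from 0). *)
Definition bd_coef (K : fieldType) (V : finType) (A B : {set V}) : K :=
  if B \subset A then
    \sum_(v in A :\: B) (-1) ^+ #|[set x in A | (enum_rank x < enum_rank v)%N]|
  else 0.

(* Boundary matrix (row-vector convention) from faces with k+1 vertices
   to faces with k vertices, in the augmented (reduced) chain complex. *)
Definition bdmx (K : fieldType) (V : finType) (E : rel V) (k : nat) :
    'M[K]_(nfaces E k.+1, nfaces E k) :=
  \matrix_(i, j) bd_coef K (enum_val i) (enum_val j).

Definition cycmx (K : fieldType) (V : finType) (E : rel V) (k : nat) :
    'M[K]_(nfaces E k) :=
  match k return 'M[K]_(nfaces E k) with
  | 0 => 1%:M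
  | j.+1 => kermx (bdmx K E j)
  end.

(* dim_K of reduced homology H~_{k-1}(cl(G); K) = cycles / boundaries *)
Definition red_betti (K : fieldType) (V : finType) (E : rel V) (k : nat) : nat :=
  \rank (cycmx K E k :\: bdmx K E k)%MS.

(* total reduced Betti number sum_{i >= -1} dim H~_i(cl(G); K);
   faces have at most #|V| vertices, so k ranges over 0 .. #|V|+1. *)
Definition total_betti (K : fieldType) (V : finType) (E : rel V) : nat :=
  \sum_(k < #|V|.+2) red_betti K E k.

Definition has_induced (W V : finType) (EH : rel W) (E : rel V) : Prop :=
  exists f : W -> V, injective f /\ forall a b, EH a b = E (f a) (f b).

Definition Kmp_rel (m : nat) : rel ('I_m * 'I_5) := fun a b => a.1 != b.1.

Definition join_rel (p q : nat) : rel (('I_p * 'I_5) + ('I_q * 'I_4)) :=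
  fun a b => match a, b with
             | inl x, inl y => x.1 != y.1
             | inr x, inr y => x.1 != y.1
             | _, _ => true
             end.

Arguments Kmp_rel m : clear implicits.
Arguments join_rel p q : clear implicits.
Arguments total_betti K {V} E.

(* Main.v *)
Require Import Defs.
From HB Require Import structures.
From mathcomp Require Import all_boot all_order all_algebra.
From mathcomp Require Import reals exp.
From mathcomp Require Import zify ring lra.
Set Implicit Arguments. Unset Strict Implicit. Unset Printing Implicit Defensive.
Import Order.TTheory GRing.Theory Num.Theory.
Local Open Scope ring_scope.

(** By rank-nullity the total reduced Betti number b(G) is the number of cliques minus
    twice the total rank of the boundary maps. Ordering the cliques by whether they
    contain a vertex v makes the boundary block triangular, whence
    b(G) <= b(G - v) + b(lk v), and b vanishes on cones.

    Let v have the fewest non-neighbours, d of them. Deleting these one by one leaves a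
    cone over v, so b(G) is at most the sum of d terms b(L), each L having at most
    n - d - 1 vertices. With a = 3^(1/4) this closes the induction for d <> 4, because
    d <= a^(d+1). For d = 4, if some non-neighbour of v can be deleted last with a link
    of at most n - 6 vertices, then 3 a^(-5) + a^(-6) <= 1 suffices. Otherwise v and its
    non-neighbours form an I_5 joined to the rest of G, the rest contains no K_{5,...,5}
    with one part fewer, and the factor 4 / a^5 is spent.

    For the extremal graph the absolute value of the reduced Euler characteristic, a
    lower bound for b, already equals 4^(m-1) 3^q. *)

(** * Ranks of submatrices and of block triangular matrices *)

Lemma mxrank_mxsub (F : fieldType) (m n m' n' : nat) (f : 'I_m' -> 'I_m)
    (g : 'I_n' -> 'I_n) (A : 'M[F]_(m, n)) :
  (\rank (mxsub f g A) <= \rank A)%N.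
Proof.
rewrite mxsubrc; apply: leq_trans (mxrankS (rowsub_sub _ _)) _.
rewrite -mxrank_tr trmx_mxsub -[leqRHS]mxrank_tr.
exact: mxrankS (rowsub_sub _ _).
Qed.

(** Multiplying by [Y] keeps the last [n2] columns, so the image has the rank of [C], while the rows
    of [row_mx A 0] lie in the kernel of [Y]. *)
Lemma mxrank_lblock (F : fieldType) (m1 m2 n1 n2 : nat) (A : 'M[F]_(m1, n1))
    (B : 'M_(m2, n1)) (C : 'M_(m2, n2)) :
  (\rank A + \rank C <= \rank (block_mx A 0 B C))%N.
Proof.
set M := block_mx A 0 B C.
pose Y : 'M[F]_(n1 + n2, n2) := col_mx 0 1%:M.
have MY : M *m Y = col_mx 0 C.
  by rewrite /M /block_mx mul_col_mx !mul_row_col !mulmx0 !mulmx1 !add0r.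
rewrite -(mxrank_mul_ker M Y) MY rank_col_0mx addnC leq_add2l.
rewrite -(rank_row_mx0 n2 A); apply: mxrankS; rewrite sub_capmx; apply/andP; split.
  rewrite /M /block_mx -[X in (X <= _)%MS](col_mxKu _ (row_mx B C)) usubmxEsub.
  exact: rowsub_sub.
by apply/sub_kermxP; rewrite mul_row_col mul0mx mulmx0 addr0.
Qed.

(** Indexing by subsets of finite types turns inclusions of face sets into submatrices; on sets of
    cliques this is the boundary matrix [bdmx]. *)
Definition setmx (K : fieldType) (X Y : finType) (M : X -> Y -> K)
    (S : {set X}) (T : {set Y}) : 'M[K]_(#|S|, #|T|) :=
  \matrix_(i, j) M (enum_val i) (enum_val j).

Lemma mxrank_setmx_ge (K : fieldType) (X Y : finType) (M : X -> Y -> K)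
    (S : {set X}) (T : {set Y}) (m n : nat) (f : 'I_m -> X) (g : 'I_n -> Y) :
    (forall i, f i \in S) -> (forall j, g j \in T) ->
  (\rank (\matrix_(i, j) M (f i) (g j)) <= \rank (setmx M S T))%N.
Proof.
move=> fS gT.
have [f' f'E] : exists f' : 'I_m -> 'I_#|S|, forall i, enum_val (f' i) = f i.
  apply: (@fin_all_exists _ (fun=> 'I_#|S|) (fun i u => enum_val u = f i)) => i.
  by exists (enum_rank_in (fS i) (f i)); rewrite enum_rankK_in.
have [g' g'E] : exists g' : 'I_n -> 'I_#|T|, forall i, enum_val (g' i) = g i.
  apply: (@fin_all_exists _ (fun=> 'I_#|T|) (fun i u => enum_val u = g i)) => i.
  by exists (enum_rank_in (gT i) (g i)); rewrite enum_rankK_in.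
have -> : \matrix_(i, j) M (f i) (g j) = mxsub f' g' (setmx M S T).
  by apply/matrixP=> i j; rewrite !mxE f'E g'E.
exact: mxrank_mxsub.
Qed.

Lemma mxrank_setmxS (K : fieldType) (X Y : finType) (M : X -> Y -> K)
    (S S' : {set X}) (T T' : {set Y}) :
  S' \subset S -> T' \subset T ->
  (\rank (setmx M S' T') <= \rank (setmx M S T))%N.
Proof.
move=> sS sT; apply: mxrank_setmx_ge => i.
  exact: (subsetP sS) (enum_valP i).
exact: (subsetP sT) (enum_valP i).
Qed.

Lemma mxrank_scale_rows_cols (K : fieldType) (m n : nat) (A B : 'M[K]_(m, n))
    (a : 'I_m -> K) (b : 'I_n -> K) :
    (forall i, a i != 0) -> (forall j, b j != 0) ->
    (forall i j, B i j = a i * b j * A i j) ->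
  \rank B = \rank A.
Proof.
move=> a0 b0 BE.
have -> : B = diag_mx (\row_i a i) *m A *m diag_mx (\row_j b j).
  by apply/matrixP=> i j; rewrite mul_mx_diag mul_diag_mx !mxE BE mulrAC.
have U p (c : 'I_p -> K) : (forall i, c i != 0) ->
    row_full (diag_mx (\row_i c i)) /\ row_free (diag_mx (\row_i c i)).
  move=> c0; rewrite row_full_unit row_free_unit unitmxE det_diag unitfE.
  suff -> : \prod_i (\row_i0 c i0) 0 i != 0 by [].
  by apply/prodf_neq0 => i _; rewrite mxE.
rewrite mxrankMfree; last exact: (U _ _ b0).2.
by rewrite (eqmxMfull _ (U _ _ a0).1).
Qed.

(** Rows [S1], [f S2] against columns [T1], [g T2] form a block lower triangular matrix. The factors
    [a] and [b] will absorb the signs of the boundary map. *)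
Lemma mxrank_setmx_lblock (K : fieldType) (X Y X' Y' : finType)
    (M : X -> Y -> K) (M' : X' -> Y' -> K)
    (S S1 : {set X}) (T T1 : {set Y}) (S2 : {set X'}) (T2 : {set Y'})
    (f : X' -> X) (g : Y' -> Y) (a : X' -> K) (b : Y' -> K) :
    S1 \subset S -> T1 \subset T ->
    {in S2, forall x, f x \in S} -> {in T2, forall y, g y \in T} ->
    {in S1 & T2, forall x y, M x (g y) = 0} ->
    (forall x, a x != 0) -> (forall y, b y != 0) ->
    {in S2 & T2, forall x y, M (f x) (g y) = a x * b y * M' x y} ->
  (\rank (setmx M S1 T1) + \rank (setmx M' S2 T2) <= \rank (setmx M S T))%N.
Proof.
move=> sS sT fS gT M0 a0 b0 MM'.
pose f' (i : 'I_(#|S1| + #|S2|)) :=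
  match split i with inl j => enum_val j | inr j => f (enum_val j) end.
pose g' (i : 'I_(#|T1| + #|T2|)) :=
  match split i with inl j => enum_val j | inr j => g (enum_val j) end.
have f'S i : f' i \in S.
  rewrite /f'; case: split => j; first exact: (subsetP sS) (enum_valP j).
  exact: fS (enum_valP j).
have g'T i : g' i \in T.
  rewrite /g'; case: split => j; first exact: (subsetP sT) (enum_valP j).
  exact: gT (enum_valP j).
apply: leq_trans (mxrank_setmx_ge M f'S g'T).
set Z := \matrix_(_, _) _.
have Zr : ursubmx Z = 0.
  apply/matrixP=> i j; rewrite !mxE /f' /g' (unsplitK (inl i)) (unsplitK (inr j)).
  by rewrite M0 ?enum_valP.
have -> : setmx M S1 T1 = ulsubmx Z.
  apply/matrixP=> i j; rewrite !mxE /f' /g'.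
  by rewrite (unsplitK (inl i)) (unsplitK (inl j)).
have -> : \rank (setmx M' S2 T2) = \rank (drsubmx Z).
  symmetry; apply: (@mxrank_scale_rows_cols _ _ _ _ _
    (fun i => a (enum_val i)) (fun j => b (enum_val j))) => // i j.
  rewrite !mxE /f' /g' (unsplitK (inr i)) (unsplitK (inr j)).
  by rewrite MM' ?enum_valP.
by rewrite -[in leqRHS](submxK Z) Zr; apply: mxrank_lblock.
Qed.

Lemma mxrank_setmx_diag (K : fieldType) (X Y Z : finType) (M : X -> Y -> K)
    (S : {set X}) (T : {set Y}) (P : {set Z}) (f : Z -> X) (g : Z -> Y) :
    {in P, forall z, f z \in S} -> {in P, forall z, g z \in T} ->
    {in P & P, forall z z', (M (f z) (g z') != 0) = (z == z')} ->
  (#|P| <= \rank (setmx M S T))%N.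
Proof.
move=> fS gT Mdiag.
have fS' (i : 'I_#|P|) : f (enum_val i) \in S by exact: fS (enum_valP i).
have gT' (i : 'I_#|P|) : g (enum_val i) \in T by exact: gT (enum_valP i).
apply: leq_trans (mxrank_setmx_ge M fS' gT').
pose c (i : 'I_#|P|) := M (f (enum_val i)) (g (enum_val i)) : K.
have -> : \matrix_(i, j) M (f (enum_val i)) (g (enum_val j))
    = diag_mx (\row_(i < #|P|) c i).
  apply/matrixP=> i j; rewrite !mxE; have [->|ij] := eqVneq i j; first by rewrite mulr1n.
  rewrite mulr0n; apply/eqP; have := Mdiag _ _ (enum_valP i) (enum_valP j).
  by rewrite (inj_eq enum_val_inj) (negbTE ij) => /negbFE.
rewrite mxrank_unit // unitmxE det_diag unitfE.
by apply/prodf_neq0 => i _; rewrite mxE /c Mdiag ?eqxx ?enum_valP.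
Qed.

(** * Cliques inside a vertex set and inside links *)

Lemma is_cliqueP (V : finType) (E : rel V) (A : {set V}) :
  reflect {in A &, forall x y, x != y -> E x y} (is_clique E A).
Proof.
apply: (iffP idP) => [/forallP cA x y xA yA xy | cA].
  by move/implyP/(_ xA)/forallP/(_ y)/implyP/(_ yA)/implyP/(_ xy): (cA x).
apply/forallP=> x; apply/implyP=> xA; apply/forallP=> y.
by apply/implyP=> yA; apply/implyP; exact: cA.
Qed.

Lemma is_cliqueS (V : finType) (E : rel V) (A B : {set V}) :
  B \subset A -> is_clique E A -> is_clique E B.
Proof.
move=> /subsetP sBA /is_cliqueP cA; apply/is_cliqueP => x y xB yB.
exact: cA (sBA _ xB) (sBA _ yB).
Qed.

Lemma is_cliqueU1 (V : finType) (E : rel V) (v : V) (A : {set V}) :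
    symmetric E -> v \notin A ->
  is_clique E (v |: A) = is_clique E A && (A \subset [set u | E v u]).
Proof.
move=> symE vA; apply/idP/andP => [cvA | [/is_cliqueP cA /subsetP sA]].
  split; first exact: is_cliqueS (subsetUr _ _) cvA.
  apply/subsetP=> u uA; rewrite inE.
  apply: (is_cliqueP _ _ cvA); [exact: setU11 | exact: setU1r |].
  by apply: contraNneq vA => ->.
apply/is_cliqueP => x y; rewrite !inE => /orP[/eqP->|xA] /orP[/eqP->|yA] xy.
- by rewrite eqxx in xy.
- by have := sA _ yA; rewrite inE.
- by rewrite symE; have := sA _ xA; rewrite inE.
- exact: cA.
Qed.

(** Induced subgraphs stay subsets of the ambient type, so they all share one vertex order and the
    same boundary signs. *)
Definition cliques_in (V : finType) (E : rel V) (U : {set V}) (k : nat) :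
    {set {set V}} :=
  [set A in cliques_of_size E k | A \subset U].

Lemma in_cliques_in (V : finType) (E : rel V) (U : {set V}) (k : nat) A :
  (A \in cliques_in E U k) = [&& is_clique E A, #|A| == k & A \subset U].
Proof. by rewrite !inE andbA. Qed.

Lemma cliques_inT (V : finType) (E : rel V) (k : nat) :
  cliques_in E setT k = cliques_of_size E k.
Proof. by apply/setP=> A; rewrite inE subsetT andbT. Qed.

Lemma cliques_inS (V : finType) (E : rel V) (U W : {set V}) (k : nat) :
  W \subset U -> cliques_in E W k \subset cliques_in E U k.
Proof.
move=> sWU; apply/subsetP=> A; rewrite !in_cliques_in => /and3P[-> ->] /=.
by move=> sAW; apply: subset_trans sWU.
Qed.

Lemma cliques_in_gt (V : finType) (E : rel V) (U : {set V}) (k : nat) :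
  (#|V| < k)%N -> cliques_in E U k = set0.
Proof.
move=> ltVk; apply/setP=> A; rewrite in_cliques_in inE.
apply/negbTE/negP => /and3P[_ /eqP kA _].
by have := max_card (mem A); rewrite kA leqNgt ltVk.
Qed.

Lemma cliques_in_link (V : finType) (E : rel V) (U : {set V}) (v : V) k A :
    symmetric E -> irreflexive E -> v \in U ->
    A \in cliques_in E (U :&: [set u | E v u]) k ->
  v \notin A /\ v |: A \in cliques_in E U k.+1.
Proof.
move=> symE irrE vU; rewrite !in_cliques_in subsetI => /and4P[cA /eqP kA AU AN].
have vA : v \notin A.
  by apply/negP => /(subsetP AN); rewrite inE irrE.
by rewrite vA is_cliqueU1 // cA AN cardsU1 vA kA eqxx subUset sub1set vU AU.
Qed.

(** Removing [v] matches the cliques through [v] with the cliques of its link, one vertex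
    smaller. *)
Lemma card_cliques_inS (V : finType) (E : rel V) (U : {set V}) (v : V) k :
    symmetric E -> irreflexive E -> v \in U ->
  #|cliques_in E U k.+1| = (#|cliques_in E (U :\ v) k.+1| +
                            #|cliques_in E (U :&: [set u | E v u]) k|)%N.
Proof.
move=> symE irrE vU; set L := U :&: _.
have injv : {in cliques_in E L k &, injective (setU [set v])}.
  move=> A B /(cliques_in_link symE irrE vU)[vA _].
  move=> /(cliques_in_link symE irrE vU)[vB _] AB.
  by rewrite -(setU1K vA) AB setU1K.
rewrite -(card_in_imset injv) -cardsUI.
suff -> : cliques_in E (U :\ v) k.+1 :&: setU [set v] @: cliques_in E L k = set0.
  rewrite cards0 addn0; congr #|pred_of_set _|; apply/setP=> A.
  apply/idP/setUP => [AU | [|/imsetP[B BL ->]]]; last 2 first.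
  - exact: (subsetP (cliques_inS _ _ (subD1set _ _))).
  - by case: (cliques_in_link symE irrE vU BL).
  case: (boolP (v \in A)) AU => vA; rewrite !in_cliques_in => /and3P[cA kA sA].
    right; apply/imsetP; exists (A :\ v); last by rewrite setD1K.
    have := cA; rewrite -{1}(setD1K vA) is_cliqueU1 ?setD11 // => /andP[cAv sAN].
    rewrite in_cliques_in cAv subsetI sAN (subset_trans (subD1set _ _)) // andbT /=.
    by move: kA; rewrite (cardsD1 v) vA eqSS => ->.
  by left; rewrite cA kA subsetD1 sA vA.
apply/setP=> A; rewrite !inE; apply/negbTE/negP => /andP[+ /imsetP[B _ AE]].
by move=> /andP[_]; rewrite subsetD1 AE setU11 andbF.
Qed.

Lemma card_cliques_in0 (V : finType) (E : rel V) (U : {set V}) :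
  #|cliques_in E U 0| = 1%N.
Proof.
rewrite -(cards1 (@set0 V)); congr #|pred_of_set _|; apply/setP=> A.
rewrite in_cliques_in inE cards_eq0.
apply/and3P/eqP => [[_ /eqP->] // | ->]; rewrite sub0set eqxx.
by split=> //; apply/is_cliqueP=> x y; rewrite inE.
Qed.

(** * Boundary coefficients and boundary ranks *)

Definition vpos (V : finType) (w : V) (B : {set V}) : nat :=
  #|[set x in B | (enum_rank x < enum_rank w)%N]|.

Lemma vposU1 (V : finType) (v w : V) (B : {set V}) :
  v \notin B -> vpos w (v |: B) = ((enum_rank v < enum_rank w) + vpos w B)%N.
Proof.
move=> vB; rewrite /vpos; case vw: (enum_rank v < enum_rank w)%N => /=.
  rewrite (_ : [set x in _ | _] = v |: [set x in B | (enum_rank x < enum_rank w)%N]).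
    by rewrite cardsU1 inE (negbTE vB).
  by apply/setP=> x; rewrite !inE andb_orl; have [->|//] := eqVneq x v; rewrite vw.
rewrite add0n; congr #|pred_of_set _|; apply/setP=> x; rewrite !inE andb_orl.
by have [->|//] := eqVneq x v; rewrite vw (negbTE vB).
Qed.

Lemma bd_coefU1 (K : fieldType) (V : finType) (w : V) (B : {set V}) :
  w \notin B -> bd_coef K (w |: B) B = (-1) ^+ vpos w B.
Proof.
move=> wB; rewrite /bd_coef subsetUr.
have -> : (w |: B) :\: B = [set w].
  apply/setP=> x; rewrite !inE andb_orr andNb orbF.
  by have [->|] := eqVneq x w; rewrite ?wB ?andbF.
by rewrite big_set1 -/(vpos w (w |: B)) vposU1 // ltnn.
Qed.

Lemma bd_coef_eq0 (K : fieldType) (V : finType) (A B : {set V}) :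
  ~~ (B \subset A) -> bd_coef K A B = 0.
Proof. by rewrite /bd_coef => /negbTE->. Qed.

Lemma facetP (V : finType) (A B : {set V}) :
  B \subset A -> #|A| = #|B|.+1 -> exists2 w, w \notin B & A = w |: B.
Proof.
move=> sBA cA; have : #|A :\: B| == 1%N by rewrite cardsDS // cA subSnn.
case/cards1P=> w ABw; have := set11 w; rewrite -ABw inE => /andP[wB wA].
by exists w; rewrite // -ABw setUC setDE setUIr setUCr setIT; apply/esym/setUidPr.
Qed.

Definition bdrank (K : fieldType) (V : finType) (E : rel V) (U : {set V}) (k : nat) :=
  \rank (setmx (@bd_coef K V) (cliques_in E U k.+1) (cliques_in E U k)).

Lemma bdrankS (K : fieldType) (V : finType) (E : rel V) (U W : {set V}) (k : nat) :
  W \subset U -> (bdrank K E W k <= bdrank K E U k)%N.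
Proof. by move=> sWU; apply: mxrank_setmxS; apply: cliques_inS. Qed.

Lemma bdrank_gt (K : fieldType) (V : finType) (E : rel V) (U : {set V}) (k : nat) :
  (#|V| <= k)%N -> bdrank K E U k = 0%N.
Proof.
move=> leVk; apply/eqP; rewrite -leqn0; apply: leq_trans (rank_leq_row _) _.
by rewrite cliques_in_gt ?cards0.
Qed.

(* Adding v to both faces multiplies the incidence coefficient by the signs
   of moving v to the end of each face. *)
Lemma bd_coefU1U1 (K : fieldType) (V : finType) (v : V) (A B : {set V}) :
    v \notin A -> v \notin B -> #|A| = #|B|.+1 ->
  let e (C : {set V}) : K := (-1) ^+ #|[set x in C | (enum_rank v < enum_rank x)%N]| in
  bd_coef K (v |: A) (v |: B) = e A * e B * bd_coef K A B.
Proof.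
move=> vA vB cAB e.
have [sBA|nsBA] := boolP (B \subset A); last first.
  rewrite [bd_coef K A B]bd_coef_eq0 // mulr0 bd_coef_eq0 //.
  apply: contra nsBA => sBA; rewrite -(setU1K vA) subsetD1 vB andbT.
  exact: subset_trans (subsetUr _ _) sBA.
have [w wB AE] := facetP sBA cAB.
have wv : w != v by apply: contraNneq vA => <-; rewrite AE setU11.
have vw : (enum_rank v == enum_rank w :> nat) = false.
  by apply/negbTE; rewrite (inj_eq val_inj) (inj_eq enum_rank_inj) eq_sym.
(* The vertex [w] changes the sign [e] exactly when it comes after [v], which is also when inserting
   [v] shifts the position of [w]. *)
have eA : e A = (-1) ^+ (enum_rank v < enum_rank w)%N * e B.
  rewrite /e AE -exprD; congr (_ ^+ _); case lvw: (enum_rank v < enum_rank w)%N => /=.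
    rewrite (_ : [set x in _ | _] = w |: [set x in B | (enum_rank v < enum_rank x)%N]).
      by rewrite cardsU1 inE (negbTE wB).
    by apply/setP=> x; rewrite !inE andb_orl; have [->|//] := eqVneq x w; rewrite lvw.
  rewrite add0n; congr #|pred_of_set _|; apply/setP=> x; rewrite !inE andb_orl.
  by have [->|//] := eqVneq x w; rewrite lvw (negbTE wB).
have -> : v |: A = w |: (v |: B) by rewrite AE setUCA.
rewrite bd_coefU1; last by rewrite !inE (negbTE wB) (negbTE wv).
rewrite vposU1 // eA AE bd_coefU1 // exprD -mulrA.
by rewrite /e -mulrA (mulrA _ _ (_ ^+ vpos w B)) -expr2 sqrr_sign mul1r.
Qed.

(** Listing faces without [v] before faces through [v] makes the boundary matrix block lower
    triangular; the second diagonal block is, up to signs, the boundary matrix of the link, one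
    degree lower. *)
Lemma bdrankU1 (K : fieldType) (V : finType) (E : rel V) (U : {set V}) (v : V) k :
    symmetric E -> irreflexive E -> v \in U ->
  (bdrank K E (U :\ v) k.+1 + bdrank K E (U :&: [set u | E v u]) k
    <= bdrank K E U k.+1)%N.
Proof.
move=> symE irrE vU; set L := U :&: _.
pose e (C : {set V}) : K := (-1) ^+ #|[set x in C | (enum_rank v < enum_rank x)%N]|.
apply: (@mxrank_setmx_lblock _ _ _ _ _ _ _ _ _ _ _ _ _
  (setU [set v]) (setU [set v]) e e).
- by apply: cliques_inS; rewrite subD1set.
- by apply: cliques_inS; rewrite subD1set.
- by move=> A /(cliques_in_link symE irrE vU)[].
- by move=> A /(cliques_in_link symE irrE vU)[].
(* A face avoiding [v] contains no face through [v]: this is the zero block. *)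
- move=> A B; rewrite in_cliques_in subsetD1 => /and4P[_ _ _ vA] _.
  by rewrite bd_coef_eq0 // subUset sub1set (negbTE vA).
- by move=> C; rewrite signr_eq0.
- by move=> C; rewrite signr_eq0.
move=> A B AL BL.
have [vA _] := cliques_in_link symE irrE vU AL.
have [vB _] := cliques_in_link symE irrE vU BL.
apply: bd_coefU1U1 => //; move: AL BL; rewrite !in_cliques_in.
by move=> /and3P[_ /eqP-> _] /and3P[_ /eqP-> _].
Qed.

(** For base faces [A] and [B] of equal size, [B] lies in [v |: A] only if [B = A], so rows [v |: A]
    against columns [A] form a diagonal submatrix. *)
Lemma bdrank_cone (K : fieldType) (V : finType) (E : rel V) (U : {set V}) (v : V) k :
    symmetric E -> irreflexive E -> v \in U ->
    U :\ v \subset [set u | E v u] ->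
  (#|cliques_in E (U :\ v) k| <= bdrank K E U k)%N.
Proof.
move=> symE irrE vU sUN.
have LE : U :&: [set u | E v u] = U :\ v.
  apply/setP=> u; rewrite !inE; have [->|uv] := eqVneq u v; first by rewrite irrE andbF.
  have [uU|//] := boolP (u \in U).
  by have := subsetP sUN u; rewrite !inE uv uU => ->.
apply: (@mxrank_setmx_diag _ _ _ _ _ _ _ _ (setU [set v]) id).
- by move=> A; rewrite -LE => /(cliques_in_link symE irrE vU)[].
- exact: (subsetP (cliques_inS _ _ (subD1set _ _))).
move=> A B; rewrite -LE => /[dup] AL /(cliques_in_link symE irrE vU)[vA _].
move=> /[dup] BL /(cliques_in_link symE irrE vU)[vB _].
have [<-|AB] := eqVneq A B; first by rewrite bd_coefU1 ?signr_eq0.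
rewrite bd_coef_eq0 ?eqxx //; apply: contra AB => sB.
have sBA : B \subset A by rewrite -(setU1K vA) subsetD1 sB.
rewrite eq_sym eqEcard sBA; move: AL BL; rewrite !in_cliques_in.
by move=> /and3P[_ /eqP-> _] /and3P[_ /eqP-> _] /=.
Qed.

(** * Rank-nullity in the reduced chain complex *)

Lemma bdmx_mul0 (K : fieldType) (V : finType) (E : rel V) (k : nat) :
  bdmx K E k.+1 *m bdmx K E k = 0.
Proof.
apply/matrixP=> i j; rewrite !mxE.
under eq_bigr do rewrite !mxE.
set A := enum_val i; set C := enum_val j.
have /setIdP[cA /eqP kA] : A \in cliques_of_size E k.+2 by apply: enum_valP.
have /setIdP[cC /eqP kC] : C \in cliques_of_size E k by apply: enum_valP.
rewrite -(big_enum_val (A := [in cliques_of_size E k.+1])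
  (fun B => bd_coef K A B * bd_coef K B C)) /=.
have [sCA|nsCA] := boolP (C \subset A); last first.
  apply: big1 => B _.
  have [sBA|/(bd_coef_eq0 K)->] := boolP (B \subset A); last by rewrite mul0r.
  rewrite [bd_coef K B C]bd_coef_eq0 ?mulr0 //.
  by apply: contra nsCA => sCB; apply: subset_trans sBA.
have : #|A :\: C| == 2%N by rewrite cardsDS // kA kC -addn2 addKn.
case/cards2P=> x [y [xy ACE]].
have /setDP[xA xC] : x \in A :\: C by rewrite ACE !inE eqxx.
have /setDP[yA yC] : y \in A :\: C by rewrite ACE !inE eqxx orbT.
have AE : A = x |: (y |: C).
  by rewrite -(setID A C) ACE (setIidPr sCA) setUC setUA.
have xyC : x \notin y |: C by rewrite !inE (negbTE xy).
have yxC : y \notin x |: C by rewrite !inE eq_sym (negbTE xy).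
have facet u : u \in A -> u \notin C -> u |: C \in cliques_of_size E k.+1.
  move=> uA uC; rewrite inE cardsU1 uC kC eqxx andbT.
  by apply: is_cliqueS cA; rewrite subUset sub1set uA.
(* Only [x |: C] and [y |: C] lie strictly between [C] and [A], so two terms survive. *)
rewrite (bigD1 (x |: C)) ?facet //= (bigD1 (y |: C)) /=; last first.
  rewrite facet //=; apply: contraNneq yxC => <-; exact: setU11.
rewrite big1 ?addr0 => [|B /andP[/andP[/setIdP[_ /eqP kB] Bx] By]]; last first.
  have [sBA|/(bd_coef_eq0 K)->] := boolP (B \subset A); last by rewrite mul0r.
  have [sCB|/(bd_coef_eq0 K)->] := boolP (C \subset B); last by rewrite mulr0.
  have [|w wC BE] := facetP sCB; first by rewrite kB kC.
  have : w \in A :\: C by rewrite inE wC (subsetP sBA) // BE setU11.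
  by rewrite ACE !inE => /orP[] /eqP we; rewrite BE we eqxx in Bx By.
have Dx : bd_coef K A (x |: C) = (-1) ^+ vpos y (x |: C).
  by rewrite AE setUCA bd_coefU1.
have Dy : bd_coef K A (y |: C) = (-1) ^+ vpos x (y |: C) by rewrite AE bd_coefU1.
rewrite Dx Dy !bd_coefU1 // !vposU1 //.
(* Exactly one of [x], [y] precedes the other, which gives the two terms opposite signs. *)
have : (enum_rank x == enum_rank y :> nat) = false.
  by apply/negbTE; rewrite (inj_eq val_inj) (inj_eq enum_rank_inj).
rewrite !exprD; set a := _ ^+ vpos y C; set b := _ ^+ vpos x C.
case: ltngtP => // _ _; rewrite expr0 expr1 mul1r !mulN1r mulNr (mulrC b).
  by rewrite addNr.
by rewrite subrr.
Qed.

(** Rank of the boundary map leaving the faces with [k] vertices; the value 0 at [k = 0] matches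
    [cycmx], where the empty face is a cycle. *)
Definition outrank (K : fieldType) (V : finType) (E : rel V) (k : nat) : nat :=
  if k is j.+1 then bdrank K E setT j else 0%N.

Lemma bdrankT (K : fieldType) (V : finType) (E : rel V) (k : nat) :
  bdrank K E setT k = \rank (bdmx K E k).
Proof. by rewrite /bdrank !cliques_inT. Qed.

(** Cycles have dimension [nfaces] minus the outgoing rank, and boundaries are cycles whose
    dimension is the incoming rank. The additive form avoids truncated subtraction. *)
Lemma red_bettiE (K : fieldType) (V : finType) (E : rel V) (k : nat) :
  (red_betti K E k + (outrank K E k + outrank K E k.+1) = nfaces E k)%N.
Proof.
have cyc : (\rank (cycmx K E k) + outrank K E k = nfaces E k)%N.
  case: k => [|k] /=; first by rewrite mxrank1 addn0.
  by rewrite mxrank_ker bdrankT subnK // rank_leq_row.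
have bd_cyc : (bdmx K E k <= cycmx K E k)%MS.
  case: k {cyc} => [|k] /=; first exact: submx1.
  by apply/sub_kermxP; exact: bdmx_mul0.
have /capmx_idPr capE := bd_cyc.
rewrite -cyc -(mxrank_cap_compl (cycmx K E k) (bdmx K E k)) capE /= bdrankT.
by rewrite /red_betti; lia.
Qed.

(* By rank-nullity, the total reduced Betti number of the clique complex of the
   subgraph induced on U. *)
Definition tbetti (K : fieldType) (V : finType) (E : rel V) (U : {set V}) : nat :=
  (\sum_(k < #|V|.+2) #|cliques_in E U k| - 2 * \sum_(k < #|V|.+2) bdrank K E U k)%N.

Lemma sum_ord_recr0 (n : nat) (g : nat -> nat) :
  g n = 0%N -> (\sum_(k < n) g k = \sum_(k < n.+1) g k)%N.
Proof. by move=> gn; rewrite [RHS]big_ord_recr /= gn addn0. Qed.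

Lemma total_bettiE (K : fieldType) (V : finType) (E : rel V) :
  total_betti K E = tbetti K E setT.
Proof.
have sumE : (\sum_(k < #|V|.+2) #|cliques_in E setT k| = total_betti K E +
    2 * \sum_(k < #|V|.+2) bdrank K E setT k)%N.
  under eq_bigr do rewrite cliques_inT -/(nfaces E _) -(red_bettiE K).
  rewrite !big_split /= mul2n -addnn; congr (_ + (_ + _))%N.
  (* Outgoing ranks are the incoming ones shifted by one degree; the rank lost at the top end is
     zero. *)
  by rewrite big_ord_recl /= add0n (@sum_ord_recr0 _ (bdrank K E setT)) // bdrank_gt.
by rewrite /tbetti sumE addnK.
Qed.

(** * Deleting vertices, and cones *)

Lemma tbetti_del (K : fieldType) (V : finType) (E : rel V) (U : {set V}) (v : V) :
    symmetric E -> irreflexive E -> v \in U ->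
  (tbetti K E U <= tbetti K E (U :\ v) + tbetti K E (U :&: [set u | E v u]))%N.
Proof.
move=> symE irrE vU; rewrite /tbetti; set L := U :&: _.
have fE : (\sum_(k < #|V|.+2) #|cliques_in E U k| =
    \sum_(k < #|V|.+2) #|cliques_in E (U :\ v) k| +
    \sum_(k < #|V|.+2) #|cliques_in E L k|)%N.
  (* The link enters one degree lower, so its sum loses the top term, which vanishes because no
     clique has [#|V|.+1] vertices. *)
  rewrite -[X in (_ + X)%N](@sum_ord_recr0 _ (fun k => #|cliques_in E L k|)); last first.
    by rewrite cliques_in_gt ?cards0.
  rewrite [LHS]big_ord_recl [X in _ = (X + _)%N]big_ord_recl !card_cliques_in0 -addnA.
  congr (_ + _)%N; rewrite -big_split; apply: eq_bigr => k _.
  exact: card_cliques_inS.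
have rE : (\sum_(k < #|V|.+2) bdrank K E (U :\ v) k +
    \sum_(k < #|V|.+2) bdrank K E L k <= \sum_(k < #|V|.+2) bdrank K E U k)%N.
  rewrite -[X in (_ + X)%N](@sum_ord_recr0 _ (bdrank K E L)) ?bdrank_gt //.
  rewrite [leqRHS]big_ord_recl [X in (X + _ <= _)%N]big_ord_recl -addnA.
  apply: leq_add; first by apply: bdrankS; rewrite subD1set.
  by rewrite -big_split; apply: leq_sum => k _; exact: bdrankU1.
(* Additive face counts and superadditive ranks suffice even for truncated subtraction. *)
lia.
Qed.

(** A cone has twice as many faces as its base, and its boundary ranks sum to at least the number of
    base faces. *)
Lemma tbetti_cone (K : fieldType) (V : finType) (E : rel V) (U : {set V}) (v : V) :
    symmetric E -> irreflexive E -> v \in U ->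
    U :\ v \subset [set u | E v u] ->
  tbetti K E U = 0%N.
Proof.
move=> symE irrE vU sUN; apply/eqP; rewrite subn_eq0.
have LE : U :&: [set u | E v u] = U :\ v.
  apply/setP=> u; rewrite !inE; have [->|uv] := eqVneq u v; first by rewrite irrE andbF.
  have [uU|//] := boolP (u \in U).
  by have := subsetP sUN u; rewrite !inE uv uU => ->.
have leD (k : nat) : (#|cliques_in E (U :\ v) k| <= bdrank K E U k)%N.
  exact: bdrank_cone.
apply: (@leq_trans (2 * \sum_(k < #|V|.+2) #|cliques_in E (U :\ v) k|)%N); last first.
  by rewrite leq_mul2l /=; apply: leq_sum.
rewrite mul2n -addnn.
rewrite -[X in (_ + X)%N](@sum_ord_recr0 _ (fun k => #|cliques_in E (U :\ v) k|)); last first.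
  by rewrite cliques_in_gt ?cards0.
rewrite [leqLHS]big_ord_recl [X in (_ <= X + _)%N]big_ord_recl !card_cliques_in0 -addnA.
rewrite leq_add2l -big_split; apply: leq_sum => k _.
by rewrite (card_cliques_inS _ symE irrE vU) LE.
Qed.

Lemma tbetti0 (K : fieldType) (V : finType) (E : rel V) : (tbetti K E set0 <= 1)%N.
Proof.
apply: leq_trans (leq_subr _ _) _; rewrite big_ord_recl card_cliques_in0 big1 // => k _.
apply: eq_card0 => A; rewrite in_cliques_in subset0; apply/negP => /and3P[_ + /eqP A0].
by rewrite A0 cards0.
Qed.

(** The vertices of [S] are deleted one at a time. The link met at each stage depends on the earlier
    deletions, so the bound is assumed for every [L] inside the neighbourhood. *)
Lemma tbetti_del_set (K : fieldType) (R : numDomainType) (V : finType) (E : rel V)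
    (U S : {set V}) (c : R) :
    symmetric E -> irreflexive E -> S \subset U ->
    {in S, forall u (L : {set V}), L \subset U :&: [set x | E u x] ->
      (tbetti K E L)%:R <= c} ->
  (tbetti K E U)%:R <= (tbetti K E (U :\: S))%:R + #|S|%:R * c.
Proof.
move=> symE irrE; move nS: #|S| => n; elim: n S nS => [|n IH] S nS sSU cS.
  by rewrite (cards0_eq nS) setD0 mul0r addr0.
have /card_gt0P[u uS] : (0 < #|S|)%N by rewrite nS.
have nSu : #|S :\ u| = n by move: nS; rewrite (cardsD1 u) uS => -[].
have {IH} IH := IH _ nSu (subset_trans (subD1set _ _) sSU)
  (fun x xS => cS x (subsetP (subD1set _ _) x xS)).
apply: le_trans IH _; rewrite -natr1 mulrDl mul1r [_ * c + c]addrC addrA lerD2r.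
have uUS : u \in U :\: (S :\ u) by rewrite !inE eqxx (subsetP sSU).
have UE : (U :\: (S :\ u)) :\ u = U :\: S.
  by rewrite setDDl setUC setD1K.
have := tbetti_del K symE irrE uUS; rewrite UE -(ler_nat R) natrD => /le_trans.
apply; rewrite lerD2l; apply: cS uS _ _.
by apply: setSI; rewrite subsetDl.
Qed.

(** * The Euler characteristic as a lower bound *)

Lemma euler_le_total_betti (K : fieldType) (R : numDomainType) (V : finType) (E : rel V) :
  `|\sum_(A : {set V} | is_clique E A) (-1) ^+ #|A| : R| <= (total_betti K E)%:R.
Proof.
have -> : \sum_(A : {set V} | is_clique E A) (-1) ^+ #|A| =
    \sum_(k < #|V|.+2) (-1) ^+ k * (nfaces E k)%:R :> R.
  have ltA (A : {set V}) : (#|A| < #|V|.+2)%N by rewrite ltnS leqW // max_card.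
  rewrite (partition_big (fun A => Ordinal (ltA A)) xpredT) //=.
  apply: eq_bigr => k _; rewrite mulr_natr -sumr_const.
  apply: eq_big => [A|A /andP[_ /eqP <-] //].
  by rewrite inE.
(* Each boundary rank occurs in two consecutive degrees with opposite signs; only the last survives,
   and it is zero for [n = #|V|.+2]. *)
have tel n : \sum_(k < n) (-1) ^+ k * ((outrank K E k)%:R + (outrank K E k.+1)%:R) =
    - ((-1) ^+ n * (outrank K E n)%:R) :> R.
  elim: n => [|n IHn]; first by rewrite big_ord0 mulr0 oppr0.
  by rewrite big_ord_recr /= IHn exprS; ring.
under eq_bigr do rewrite -(red_bettiE K) natrD mulrDr natrD.
rewrite big_split /= tel /= bdrank_gt // mulr0 oppr0 addr0.
apply: le_trans (ler_norm_sum _ _ _) _; rewrite natr_sum.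
by apply: ler_sum => k _; rewrite normrM normrX normrN1 expr1n mul1r normr_nat.
Qed.

(* A clique of a complete multipartite graph picks at most one vertex in every part,
   which factors the Euler characteristic. *)
Lemma euler_multipartite (R : comNzRingType) (V I : finType) (p : V -> I) :
  \sum_(A : {set V} | is_clique (fun x y => p x != p y) A) (-1) ^+ #|A| =
  \prod_(i : I) (1 - #|[set x | p x == i]|%:R) :> R.
Proof.
(* A choice for part [i] is a vertex of that part, or [None] if the part is skipped. *)
pose ok i (o : option V) := if o is Some x then p x == i else true.
pose F (i : I) (o : option V) : R := if o is Some _ then -1 else 1.
have -> : \prod_(i : I) (1 - #|[set x | p x == i]|%:R) =
    \prod_i \sum_(o | ok i o) F i o :> R.
  apply: eq_bigr => i _; rewrite (bigD1 None) //=; congr (_ + _).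
  rewrite (eq_bigr (fun=> -1)); last by case=> [x|] // /andP[].
  rewrite (eq_bigl [in Some @: [set x | p x == i]]) => [|o]; last first.
    apply/andP/imsetP => [|[x + ->]]; last by rewrite inE.
    by case: o => [x [px _]|[]//]; exists x; rewrite ?inE.
  rewrite sumr_const card_imset; last exact: Some_inj.
  by rewrite mulNrn.
rewrite bigA_distr_big_dep.
(* [h] collects the chosen vertices; [h'] reads off the vertex that a clique has in each part. *)
pose h (g : {ffun I -> option V}) := [set x | g (p x) == Some x].
pose h' (A : {set V}) := [ffun i => [pick x in A | p x == i]].
have pinj (A : {set V}) : is_clique (fun x y => p x != p y) A -> {in A &, injective p}.
  by move=> /is_cliqueP cA x y xA yA; apply: contra_eq; exact: cA.
rewrite (reindex_onto h h') => [|A cA]; last first.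
  apply/setP=> x; rewrite inE ffunE; case: pickP => [y /andP[yA /eqP pyx]|no].
    apply/eqP/idP => [[<-] //|xA]; congr Some; exact: (pinj A cA y x yA xA pyx).
  by apply/esym/negbTE; have := no x; rewrite eqxx andbT => ->.
have famP (g : {ffun I -> option V}) : g \in family ok ->
    forall i x, g i = Some x -> p x = i.
  by move=> /familyP gf i x gi; have := gf i; rewrite unfold_in gi => /eqP.
apply: eq_big => [g|g /andP[cg /eqP hg]].
  apply/andP/idP => [[cg /eqP <-]|gf].
    apply/familyP => i; rewrite unfold_in ffunE.
    by case: pickP => [x /andP[]|].
  split.
    apply/is_cliqueP => x y; rewrite !inE => /eqP gx /eqP gy.
    by apply: contra => /eqP pxy; apply/eqP; move: gx; rewrite pxy gy => -[].
  apply/eqP/ffunP=> i; rewrite ffunE; case: pickP => [x|no].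
    by rewrite inE => /andP[/eqP gx /eqP <-].
  case gi: (g i) => [x|] //; have := no x.
  by rewrite inE (famP _ gf _ _ gi) gi !eqxx.
(* As [p] is injective on a clique, the size of the clique is the number of parts it meets. *)
rewrite -(card_in_imset (pinj _ cg)) -[LHS]mul1r -(prodr_const _ (-1)) mul1r.
rewrite [LHS]big_mkcond; apply: eq_bigr => i _; rewrite /F.
case gi: (g i) => [x|]; last first.
  case: ifP => // /imsetP[x]; rewrite inE => /eqP gx ix.
  by rewrite ix gx in gi.
have : h' (h g) i = Some x by rewrite hg.
rewrite ffunE; case: pickP => // y /andP[yg /eqP <-] _.
by rewrite imset_f.
Qed.

(** * Estimates for the fourth root of 3 *)

Lemma root4_3_bounds (R : realFieldType) (a : R) :
  0 < a -> a ^+ 4 = 3 -> 13 / 10 <= a <= 4 / 3.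
Proof.
move=> a0 a4; apply/andP; split.
  rewrite -(@ler_pXn2r _ 4) ?nnegrE ?(ltW a0) // ?a4; last by lra.
  by rewrite !exprS expr0; lra.
rewrite -(@ler_pXn2r _ 4) ?nnegrE ?(ltW a0) // ?a4; last by lra.
by rewrite !exprS expr0; lra.
Qed.

(** Equality holds at [d = 3], and [d = 4] fails because [a ^+ 5 = 3 * a < 4]. From [d = 7] on, the
    factor [a >= 13 / 10] outgrows the ratio of consecutive values of [d]. *)
Lemma natr_le_root4_3X (R : realFieldType) (a : R) (d : nat) :
  0 < a -> a ^+ 4 = 3 -> d != 4%N -> d%:R <= a ^+ d.+1.
Proof.
move=> a0 a4; have /andP[la ua] := root4_3_bounds a0 a4.
have a2 : 169 / 100 <= a ^+ 2 by rewrite expr2; nra.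
have a3 : 2197 / 1000 <= a ^+ 3 by rewrite exprS; nra.
have a6 : a ^+ 6 = 3 * a ^+ 2 by rewrite (exprD a 4 2) a4.
have a7 : a ^+ 7 = 3 * a ^+ 3 by rewrite (exprD a 4 3) a4.
have a8 : a ^+ 8 = 9 by rewrite (exprD a 4 4) a4; lra.
case: d => [_|[_|[_|[_|[//|[_|[_|d _]]]]]]]; rewrite ?expr1 ?a4 ?a6 ?a7; try by lra.
elim: d => [|d IH]; first by rewrite a8; lra.
rewrite exprS; move: IH; rewrite -[d.+4.+4]addn1 natrD => IH.
have d0 : 0 <= d.+4.+3%:R :> R by rewrite ler0n.
have d7 : 7 <= d.+4.+3%:R :> R by rewrite ler_nat.
move: IH; set x := d.+4.+3%:R; set y := a ^+ _ => IH; nra.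
Qed.

(** * Induced complete multipartite subgraphs with parts of size 5 *)

Definition has_Kmp_in (m : nat) (V : finType) (E : rel V) (U : {set V}) : Prop :=
  exists f : 'I_m * 'I_5 -> V,
    [/\ injective f, forall a, f a \in U & forall a b, Kmp_rel m a b = E (f a) (f b)].

Lemma has_Kmp_inT (m : nat) (V : finType) (E : rel V) :
  has_Kmp_in m E setT -> has_induced (Kmp_rel m) E.
Proof. by case=> f [injf _ fE]; exists f. Qed.

Lemma has_Kmp_inS (m : nat) (V : finType) (E : rel V) (U W : {set V}) :
  W \subset U -> has_Kmp_in m E W -> has_Kmp_in m E U.
Proof.
move=> /subsetP sWU [f [injf fW fE]]; exists f; split=> // a; exact: sWU (fW a).
Qed.

Lemma has_Kmp_in0 (V : finType) (E : rel V) (U : {set V}) (v : V) :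
  has_Kmp_in 0 E U.
Proof. by exists (fun=> v); split=> [[[]]|[[]]|[[]]]. Qed.

Lemma has_Kmp_in_join (m : nat) (V : finType) (E : rel V) (U S T : {set V}) :
    symmetric E -> S \subset U -> T \subset U -> #|S| = 5%N ->
    {in S &, forall x y, ~~ E x y} -> {in S & T, forall x y, E x y} ->
  has_Kmp_in m E T -> has_Kmp_in m.+1 E U.
Proof.
move=> symE sSU sTU cS iS jST [g [injg gT gE]].
pose s j := enum_val (cast_ord (esym cS) j).
have sS j : s j \in S by apply: enum_valP.
have injs : injective s by move=> i j /enum_val_inj/cast_ord_inj.
have nST x y : x \in S -> y \in T -> x <> y.
  by move=> xS yT xy; have := iS _ _ xS xS; rewrite {2}xy jST.
(* Part [ord0] goes to the independent set [S]; the other parts are renumbered and go to the copy in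
   [T]. *)
exists (fun a => if unlift ord0 a.1 is Some i then g (i, a.2) else s a.2); split.
- move=> [i j] [i' j'] /=; case: unliftP => [k ->|->]; case: unliftP => [k' ->|->].
  + by move=> /injg[-> ->].
  + by move=> /esym/nST; case.
  + by move=> /nST; case.
  + by move=> /injs->.
- move=> [i j] /=; case: unliftP => [k _|_]; first exact: (subsetP sTU).
  exact: (subsetP sSU).
move=> [i j] [i' j']; rewrite /Kmp_rel /=.
case: unliftP => [k ->|->]; case: unliftP => [k' ->|->].
- by rewrite -gE /Kmp_rel /= (inj_eq lift_inj).
- by rewrite symE jST // eq_sym neq_lift.
- by rewrite jST // neq_lift.
- by rewrite eqxx (negbTE (iS _ _ _ _)).
Qed.

Lemma card_link_nonadj (V : finType) (E : rel V) (U : {set V}) (x : V) :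
    irreflexive E -> x \in U ->
  (#|U :&: [set u | E x u]| + #|[set u in U | (u != x) && ~~ E x u]|).+1 = #|U|.
Proof.
move=> irrE xU; rewrite [#|U|](cardsD1 x) xU add1n; congr _.+1.
rewrite -(cardsID [set u | E x u] (U :\ x)); congr (_ + _)%N; congr #|pred_of_set _|.
  apply/setP=> u; rewrite !inE; have [->|//] := eqVneq u x.
  by rewrite irrE !andbF.
by apply/setP=> u; rewrite !inE; case: (u \in U); rewrite ?andbF //= andbT andbC.
Qed.

(** * The upper bound, by induction on the number of vertices *)

Lemma tbetti_le (K : fieldType) (R : realFieldType) (a : R) (m : nat)
    (V : finType) (E : rel V) (U : {set V}) :
    0 < a -> a ^+ 4 = 3 -> symmetric E -> irreflexive E ->
    ~ has_Kmp_in m.+1 E U ->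
  (tbetti K E U)%:R <= (4 / a ^+ 5) ^+ m * a ^+ #|U|.
Proof.
move=> a0 a4 symE irrE; have /andP[la ua] := root4_3_bounds a0 a4.
have a1 : 1 <= a by lra.
have a5 : a ^+ 5 = 3 * a by rewrite exprSr a4.
have c1 : 1 <= 4 / a ^+ 5 by rewrite ler_pdivlMr ?exprn_gt0 // a5; lra.
(* The induction keeps [m] general, since the last case passes to one part fewer. *)
have [n leUn] := ubnP #|U|; elim: n m U leUn => // n IH m U /ltnSE leUn freeU.
have [->|[v0 v0U]] := set_0Vmem U.
  rewrite cards0 expr0 mulr1; apply: (@le_trans _ _ 1); last exact: exprn_ege1.
  by rewrite lern1 tbetti0.
pose NN x := [set u in U | (u != x) && ~~ E x u].
pose N x := U :&: [set u | E x u].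
case: (arg_minnP (fun x => #|NN x|) v0U) => v vU' minv {v0 v0U}.
have {vU'} vU : v \in U := vU'.
move nd: #|NN v| => d; rewrite nd in minv.
have NNU : NN v \subset U by apply/subsetP=> u; rewrite inE => /andP[].
(* By minimality of [d], every vertex of [U] has at least [d] non-neighbours. *)
have cardN x : x \in U -> (#|N x| + d < #|U|)%N.
  by move=> xU; have := card_link_nonadj irrE xU; have := minv _ xU; rewrite /N /NN; lia.
have cardv : (#|N v| + d).+1 = #|U| by rewrite -(card_link_nonadj irrE vU) nd.
have cone : tbetti K E (U :\: NN v) = 0%N.
  apply: (tbetti_cone _ symE irrE (v := v)); first by rewrite !inE vU eqxx.
  by apply/subsetP=> u; rewrite !inE; case: (u \in U); case: eqP; case: (E v u).
set B := (4 / a ^+ 5) ^+ m; have B0 : 0 < B by rewrite exprn_gt0 // (lt_le_trans ltr01).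
have IHB e u (L : {set V}) : u \in U -> L \subset N u -> (#|L| <= e)%N ->
    (tbetti K E L)%:R <= B * a ^+ e.
  move=> uU sLN leLe; have cN := cardN _ uU; have cL := subset_leq_card sLN.
  have sNU : L \subset U := subset_trans sLN (subsetIl _ _).
  apply: le_trans (IH m L _ _) _; [lia | by move=> /(has_Kmp_inS sNU) |].
  by rewrite ler_wpM2l ?(ltW B0) // ler_weXn2l.
have IHBd : {in NN v, forall u (L : {set V}), L \subset U :&: [set x | E u x] ->
      (tbetti K E L)%:R <= B * a ^+ #|N v|}.
  move=> u uNN L sL; have uU := subsetP NNU _ uNN.
  apply: (IHB _ u) => //; apply: leq_trans (subset_leq_card sL) _.
  by have := cardN _ uU; rewrite /N in cardv *; lia.
have [d4|d4] := eqVneq d 4%N; last first.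
  apply: le_trans (tbetti_del_set symE irrE NNU IHBd) _.
  rewrite cone add0r nd -cardv -addnS exprD [leLHS]mulrC mulrA.
  rewrite ler_pM2l ?mulr_gt0 // ?exprn_gt0 //.
  exact: natr_le_root4_3X.
rewrite d4 in nd cardv cardN minv.
(* Suppose that some [u], deleted last, has a link smaller than [N v]; the three earlier links have
   at most [#|N v|] vertices. *)
have [/existsP[u /andP[uNN small]]|nsmall] := boolP [exists u,
    (u \in NN v) && (#|(U :\: (NN v :\ u)) :&: [set x | E u x]| < #|N v|)%N].
  have uU := subsetP NNU _ uNN.
  have sSU : NN v :\ u \subset U := subset_trans (subD1set _ _) NNU.
  have cS : #|NN v :\ u| = 3%N by move: nd; rewrite (cardsD1 u) uNN; lia.
  have uW : u \in U :\: (NN v :\ u) by rewrite !inE eqxx.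
  apply: le_trans (tbetti_del_set symE irrE sSU (c := B * a ^+ #|N v|) _) _.
    by move=> x xS; apply: IHBd; move: xS; rewrite inE => /andP[].
  have := tbetti_del K symE irrE uW; rewrite setDDl setUC setD1K // cone add0n.
  rewrite -(ler_nat R) cS => le1.
  have le2 := IHB #|N v|.-1 u ((U :\: (NN v :\ u)) :&: [set x | E u x]) uU.
  rewrite -cardv; case eNv: #|N v| small le2 => [//|k] small le2.
  have {le2} le2 : (tbetti K E ((U :\: (NN v :\ u)) :&: [set x | E u x]))%:R <= B * a ^+ k.
    by apply: le2; [apply: setSI; rewrite subsetDl | rewrite -ltnS].
  apply: le_trans (lerD (le_trans le1 le2) (lexx _)) _.
  (* After division by [B * a ^+ k] the claim is [1 + 3 * a <= a ^+ 6 = 3 * a ^+ 2], which follows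
     from [13 / 10 <= a]. *)
  rewrite -addnS addSnnS exprD (exprD a 4 2) a4 exprS.
  have Bk : 0 < B * a ^+ k by rewrite mulr_gt0 // exprn_gt0.
  have -> : B * a ^+ k + 3 * (B * (a * a ^+ k)) = B * a ^+ k * (1 + 3 * a) by ring.
  by rewrite [leRHS]mulrA ler_pM2l // expr2; nra.
(* Otherwise the last link of each [u] fills all of [N v]. It lies in [N u], which by minimality is
   no larger than [N v]. *)
have sNN u : u \in NN v -> N u = N v.
  move=> uNN; have uU := subsetP NNU _ uNN.
  have big : (#|N v| <= #|(U :\: (NN v :\ u)) :&: [set x | E u x]|)%N.
    by rewrite leqNgt; apply: contra nsmall => lt; apply/existsP; exists u; rewrite uNN.
  have sub : (U :\: (NN v :\ u)) :&: [set x | E u x] \subset N v.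
    apply/subsetP=> x; rewrite !inE => /andP[/andP[+ xU] Eux].
    move: uNN; rewrite inE => /and3P[_ _ nEvu].
    have -> : x != u by apply: contraTneq Eux => ->; rewrite irrE.
    have -> : x != v by apply: contraTneq Eux => ->; rewrite symE.
    by rewrite xU /= negbK.
  have /eqP eqN : (U :\: (NN v :\ u)) :&: [set x | E u x] == N v by rewrite eqEcard sub.
  have sub2 : N v \subset N u by rewrite -eqN setSI // subsetDl.
  by apply/esym/eqP; rewrite eqEcard sub2; have := cardN _ uU; lia.
have vNN : v \notin NN v by rewrite !inE eqxx andbF.
have NS x : x \in v |: NN v -> N x = N v by rewrite in_setU1 => /orP[/eqP->|/sNN].
have join := @has_Kmp_in_join m V E U (v |: NN v) (N v) symE.
(* Equal neighbourhoods make [v |: NN v] an independent set of five vertices joined to all of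
   [N v]. *)
have {}join : has_Kmp_in m E (N v) -> has_Kmp_in m.+1 E U.
  apply: join; rewrite ?subsetIl ?subUset ?sub1set ?vU ?cardsU1 ?vNN ?nd //.
  - move=> x y /NS Nx yS; apply/negP => Exy.
    have : y \in N x.
      rewrite !inE Exy andbT; move: yS; rewrite in_setU1 => /orP[/eqP->//|].
      exact: (subsetP NNU).
    rewrite Nx; move: yS; rewrite !inE => /orP[/eqP->|/and3P[_ _ /negbTE->]].
      by rewrite irrE andbF.
    by rewrite andbF.
  - by move=> x y /NS <-; rewrite !inE => /andP[].
(* For [m = 0] these five vertices already form the forbidden graph. *)
case: m @B B0 IHB IHBd freeU join => [|m] B B0 IHB IHBd freeU join.
  by case: freeU; apply: join; exact: has_Kmp_in0.
have freeN : ~ has_Kmp_in m.+1 E (N v) by move=> /join.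
apply: le_trans (tbetti_del_set symE irrE NNU (c := (4 / a ^+ 5) ^+ m * a ^+ #|N v|) _) _.
  move=> u uNN L; rewrite -/(N u) (sNN _ uNN) => sLN; have cL := subset_leq_card sLN.
  apply: le_trans (IH m L _ _) _; [lia | by move=> /(has_Kmp_inS sLN) |].
  by rewrite ler_wpM2l ?exprn_ge0 ?(le_trans ler01) // ler_weXn2l.
rewrite cone add0r nd -cardv -addnS exprD /B (exprS (4 / a ^+ 5) m).
have a5n : a ^+ 5 != 0 by rewrite expf_neq0 // gt_eqF.
move: ((4 / a ^+ 5) ^+ m) (a ^+ #|N v|) (a ^+ 5) a5n => x y z z0.
(* Equality: the four links account for the factor [4 / a ^+ 5] times the five extra powers of
   [a]. *)
by rewrite le_eqVlt; apply/orP; left; apply/eqP; field.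
Qed.

(** * The extremal graph *)

Definition join_part (p q : nat) (x : 'I_p * 'I_5 + 'I_q * 'I_4) : 'I_p + 'I_q :=
  match x with inl y => inl y.1 | inr y => inr y.1 end.

Lemma join_relE (p q : nat) (x y : 'I_p * 'I_5 + 'I_q * 'I_4) :
  join_rel p q x y = (join_part x != join_part y).
Proof. by case: x y => x [] y. Qed.

Lemma card_join_part_inl (p q : nat) (i : 'I_p) :
  #|[set x : 'I_p * 'I_5 + 'I_q * 'I_4 | join_part x == inl i]| = 5%N.
Proof.
rewrite -[RHS](card_ord 5).
rewrite -(card_imset (f := fun j : 'I_5 => inl (i, j) : 'I_p * 'I_5 + 'I_q * 'I_4)).
  congr #|pred_of_set _|; apply/setP=> -[[k j]|[k j]]; rewrite inE.
    by apply/eqP/imsetP => [[<-]|[j' _ [-> _]] //]; exists j.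
  by apply/eqP/imsetP => [//|[]].
by move=> j j' [].
Qed.

Lemma card_join_part_inr (p q : nat) (i : 'I_q) :
  #|[set x : 'I_p * 'I_5 + 'I_q * 'I_4 | join_part x == inr i]| = 4%N.
Proof.
rewrite -[RHS](card_ord 4).
rewrite -(card_imset (f := fun j : 'I_4 => inr (i, j) : 'I_p * 'I_5 + 'I_q * 'I_4)).
  congr #|pred_of_set _|; apply/setP=> -[[k j]|[k j]]; rewrite inE.
    by apply/eqP/imsetP => [//|[]].
  by apply/eqP/imsetP => [[<-]|[j' _ [-> _]] //]; exists j.
by move=> j j' [].
Qed.

(** Each part of a copy lies in a single part of the join, which cannot have only 4 vertices.
    Distinct parts go to distinct parts, so [p.+1] parts would inject into the [p] parts of size
    5. *)
Lemma join_rel_Kmp_free (p q : nat) : ~ has_induced (Kmp_rel p.+1) (join_rel p q).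
Proof.
case=> f [injf fE].
have samepart i j j' : join_part (f (i, j)) = join_part (f (i, j')).
  by have := fE (i, j) (i, j'); rewrite join_relE /Kmp_rel eqxx /= => /esym/negbFE/eqP.
have isl i : exists k, join_part (f (i, ord0)) = inl k.
  case fi: (join_part _) => [k|k]; first by exists k.
  have inji : injective (fun j => f (i, j)) by move=> j j' /injf[].
  have : (#|[set f (i, j) | j : 'I_5]| <= 4)%N.
    rewrite -[leqRHS](card_join_part_inr p k); apply/subset_leq_card/subsetP => x.
    by case/imsetP=> j _ ->; rewrite inE (samepart i j ord0) fi.
  by rewrite card_imset // card_ord.
have [h hE] := fin_all_exists isl.
have injh : injective h.
  move=> i i' hh; have := fE (i, ord0) (i', ord0).
  by rewrite join_relE /Kmp_rel !hE hh eqxx => /negbFE/eqP.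
by have := leq_card h injh; rewrite !card_ord ltnn.
Qed.

(** The alternating count of cliques is [(1 - 5) ^+ p * (1 - 4) ^+ q]. *)
Lemma join_rel_betti_ge (K : fieldType) (p q : nat) :
  (4 ^ p * 3 ^ q <= total_betti K (join_rel p q))%N.
Proof.
rewrite -(ler_nat int); apply: le_trans (euler_le_total_betti K int (join_rel p q)).
have -> : \sum_(A : {set _} | is_clique (join_rel p q) A) (-1) ^+ #|A| =
    \prod_i (1 - #|[set x | @join_part p q x == i]|%:R) :> int.
  rewrite -euler_multipartite; apply: eq_bigl => A.
  by apply/is_cliqueP/is_cliqueP => cA x y xA yA /(cA x y xA yA); rewrite join_relE.
rewrite big_sumType /=.
under eq_bigr do rewrite card_join_part_inl.
under [X in _ * X]eq_bigr do rewrite card_join_part_inr.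
rewrite !prodr_const !card_ord normrM !normrX natrM !natrX.
by rewrite (_ : `|1 - 5%:R| = 4%:R :> int) // (_ : `|1 - 4%:R| = 3%:R :> int).
Qed.

Theorem theorem1p3 (K : fieldType) (R : realType) (m : nat) (hm : (1 <= m)%N) :
  (forall (n : nat) (V : finType) (E : rel V),
      symmetric E -> irreflexive E -> (#|V| <= n)%N ->
      ~ has_induced (Kmp_rel m) E ->
      (total_betti K E)%:R <= (4 / powR 3 (5 / 4)) ^+ (m - 1) * powR 3 (n%:R / 4) :> R)
  /\
  (forall n : nat, (5 * (m - 1) < n)%N -> (4 %| n - 5 * (m - 1))%N ->
      ~ has_induced (Kmp_rel m) (join_rel (m - 1) ((n - 5 * (m - 1)) %/ 4)) /\
      (total_betti K (join_rel (m - 1) ((n - 5 * (m - 1)) %/ 4)))%:R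
        = (4 / powR 3 (5 / 4)) ^+ (m - 1) * powR 3 (n%:R / 4) :> R).
Proof.
case: m hm => // p _; rewrite subn1 /=.
(* With [a] the fourth root of 3, the real powers of 3 become natural powers of [a]. *)
pose a : R := powR 3 4^-1.
have a0 : 0 < a by rewrite powR_gt0.
have aX n : powR 3 (n%:R / 4) = a ^+ n :> R.
  by rewrite mulrC powRrM powR_mulrn ?powR_ge0.
have a4 : a ^+ 4 = 3 by rewrite -aX divff ?powRr1 ?pnatr_eq0 ?ler0n.
have a5 : powR 3 (5 / 4) = a ^+ 5 :> R by rewrite -aX.
have upper (n : nat) (V : finType) (E : rel V) : symmetric E -> irreflexive E ->
    (#|V| <= n)%N -> ~ has_induced (Kmp_rel p.+1) E ->
    (total_betti K E)%:R <= (4 / powR 3 (5 / 4)) ^+ p * powR 3 (n%:R / 4) :> R.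
  move=> symE irrE leVn freeE; rewrite total_bettiE a5 aX.
  apply: le_trans (tbetti_le K a0 a4 symE irrE (m := p) _) _.
    by move=> /has_Kmp_inT.
  have /andP[la ua] := root4_3_bounds a0 a4.
  rewrite ler_wpM2l ?exprn_ge0 ?divr_ge0 ?exprn_ge0 ?(ltW a0) // cardsT.
  by rewrite ler_weXn2l //; lra.
split=> [|n lt_n /divnK]; first exact: upper.
set q := (_ %/ 4)%N => qE.
have nE : n = (p * 5 + q * 4)%N by lia.
have free := @join_rel_Kmp_free p q; split=> //.
apply/le_anti/andP; split.
  apply: upper => //.
  - by move=> x y; rewrite !join_relE eq_sym.
  - by move=> x; rewrite join_relE eqxx.
  by rewrite card_sum !card_prod !card_ord nE.
(* The powers [a ^+ (5 * p)] cancel against the denominators, and [a ^+ (4 * q)] is [3 ^+ q]. *)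
have -> : (4 / powR 3 (5 / 4)) ^+ p * powR 3 (n%:R / 4) = (4 ^ p * 3 ^ q)%:R :> R.
  rewrite a5 aX nE exprD mulnC [(q * 4)%N]mulnC !exprM a4 natrM !natrX expr_div_n mulrA.
  by rewrite divfK // expf_neq0 // expf_neq0 // gt_eqF.
by rewrite ler_nat join_rel_betti_ge.
Qed.
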